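(* Let $K$ be a field, $p\geq4$, and $T=\sum_{i=1}^r u_i\otimes v_i\otimes w_i\in K^{n\times n\times p}$ with slices $T_1,\ldots,T_p$. Assume: (1) the $w_i$ are pairwise linearly independent and $w_{i1}\neq0$ for all $i$ (where $w_{i1}$ is the first coordinate of $w_i$); (2) $T_1$ is invertible; (3) with $A_i=T_1^{-1}T_i$ for $i=2,\ldots,p$, for every $l\in\{3,\ldots,p\}$ there exists $m\in\{3,\ldots,p\}$, $m\ne l$, such that the triple $(A_2,A_l,A_m)$ satisfies property $(H_r)$. Then $\mathrm{rank}(T)=r$, and running Algorithm 2 on input $(T,r)$ outputs a decomposition of $T$ as a sum of $r$ rank-one tensors (which is essentially unique).
   Context: $u\otimes v\otimes w$ has entries $u_iv_jw_k$; rank is least number of rank-one tensors summing to $T$; slices $T_k=(T_{ijk})_{i,j}$; essentially unique = unique up to permutation of terms. $[X,Y]=XY-YX$, $\mathrm{Im}$ = column space. A triple $(X,Y,W)$ of $n\times n$ matrices satisfies $(H_r)$ if $\mathrm{Im}[X,Y],\mathrm{Im}[X,W],\mathrm{Im}[Y,W]$ each have dimension $2(r-n)$ and $\mathrm{Im}[X,Y]+\mathrm{Im}[X,W]$, $\mathrm{Im}[Y,X]+\mathrm{Im}[Y,W]$, $\mathrm{Im}[W,X]+\mathrm{Im}[W,Y]$ each have dimension $3(r-n)$. A commuting extension of size $r$ of a tuple $(B_1,\ldots,B_q)$ of $n\times n$ matrices is a tuple of pairwise commuting $r\times r$ matrices $Z_i$ whose top-left $n\times n$ block is $B_i$. Subroutine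 CE (commuting extension algorithm from the author's prior work): given a tuple $(B_1,\ldots,B_q)$, $q\ge3$, of $n\times n$ matrices such that for every $l\in\{2,\ldots,q\}$ some $m\notin\{1,l\}$ makes $(B_1,B_l,B_m)$ satisfy $(H_r)$, and which has a commuting extension of size $r$, it returns a commuting extension of size $r$ over $K$. Subroutine SD (simultaneous diagonalization algorithm): given $S\in K^{r\times r\times p}$ that admits a decomposition $S=\sum_{i=1}^r a_i\otimes b_i\otimes c_i$ with $(a_i)$ linearly independent, $(b_i)$ linearly independent and $(c_i)$ pairwise linearly independent, it returns a decomposition of $S$ as a sum of $r$ rank-one tensors. Algorithm 2, on input $T\in K^{n\times n\times p}$ and $r\in[n,4n/3]$: (1) compute $A_i=T_1^{-1}T_i$, $i=2,\ldots,p$; (2) compute with CE a commuting extension $(Z_2,\ldots,Z_p)$ of size $r$ of $(A_2,\ldots,A_p)$; (3) let $T'$ be the $r\times r\times p$ tensor with slices $(I_r,Z_2,\ldots,Z_p)$ and compute with SD a decomposition $T'=\sum_{i=1}^r u'_i\otimes v'_i\otimes w_i$; (4) let $U'\in M_{r,n}(K)$ have as $i$-th row the first $n$ coordinates of $u'_i$; output $T=\sum_{i=1}^r u_i\otimes v_i\otimes w_i$ where $u_i$ is the $i$-th row of $U'T_1^T$ and $v_i=(v'_{i1},\ldots,v'_{in})$. *)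

(* Defs.v *)
From HB Require Import structures.
From mathcomp Require Import all_boot all_order all_fingroup all_algebra.
Set Implicit Arguments.
Unset Strict Implicit.
Unset Printing Implicit Defensive.
Import GRing.Theory.
Local Open Scope ring_scope.

(* Indices start at 0, so T_1 is the slice of index ord0.  The dimension p of
   the paper is written q.+2: the tuple (T_2, .., T_p) is indexed by
   k : 'I_q.+1 through lift ord0 k, and its first member T_2 has k = ord0. *)

Notation tensor K m n p := {ffun 'I_m * 'I_n * 'I_p -> K}.

Definition outer (K : fieldType) (m n p : nat)
    (u : 'rV[K]_m) (v : 'rV[K]_n) (w : 'rV[K]_p) : tensor K m n p :=
  [ffun x => u 0 x.1.1 * v 0 x.1.2 * w 0 x.2].

Definition slice (K : fieldType) (m n p : nat) (T : tensor K m n p)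
    (k : 'I_p) : 'M[K]_(m, n) :=
  \matrix_(i, j) T (i, j, k).

Definition tensor_of_slices (K : fieldType) (m n p : nat)
    (M : 'I_p -> 'M[K]_(m, n)) : tensor K m n p :=
  [ffun x => M x.2 x.1.1 x.1.2].

Definition rank_one (K : fieldType) (m n p : nat) (T : tensor K m n p) : Prop :=
  T != 0 /\ exists u v w, T = outer u v w.

Definition decomposition (K : fieldType) (m n p r : nat) (T : tensor K m n p)
    (t : 'I_r -> tensor K m n p) : Prop :=
  (forall i, rank_one (t i)) /\ T = \sum_i t i.

Definition has_tensor_rank (K : fieldType) (m n p : nat) (T : tensor K m n p)
    (r : nat) : Prop :=
  (exists t : 'I_r -> tensor K m n p, decomposition T t) /\
  (forall s (t : 'I_s -> tensor K m n p), decomposition T t -> (r <= s)%N).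

Definition essentially_unique_decomposition (K : fieldType) (m n p : nat)
    (T : tensor K m n p) (r : nat) : Prop :=
  forall t t' : 'I_r -> tensor K m n p,
    decomposition T t -> decomposition T t' ->
    exists s : 'S_r, forall i, t' i = t (s i).

Definition pairwise_independent (K : fieldType) (p r : nat)
    (w : 'I_r -> 'rV[K]_p) : Prop :=
  forall i j, i != j -> free [:: w i; w j].

Definition commutator (K : fieldType) (n : nat) (X Y : 'M[K]_n) : 'M[K]_n :=
  X *m Y - Y *m X.

(* The %MS operations act on row spaces, so the column space of A is
   represented by A^T. *)
Definition Im (K : fieldType) (n : nat) (A : 'M[K]_n) : 'M[K]_n := A^T.

(* r - n is only meaningful for n <= r, which holds wherever H is used: it
   follows from the existence of a commuting extension of size r, and from the
   invertibility of a slice of a sum of r rank-one tensors. *)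
Definition H (K : fieldType) (n r : nat) (X Y W : 'M[K]_n) : Prop :=
  let br := @commutator K n in
  [/\ \rank (Im (br X Y)) = (2 * (r - n))%N,
      \rank (Im (br X W)) = (2 * (r - n))%N
    & \rank (Im (br Y W)) = (2 * (r - n))%N] /\
  [/\ \rank (Im (br X Y) + Im (br X W))%MS = (3 * (r - n))%N,
      \rank (Im (br Y X) + Im (br Y W))%MS = (3 * (r - n))%N
    & \rank (Im (br W X) + Im (br W Y))%MS = (3 * (r - n))%N].

Definition commuting_extension (K : fieldType) (n q r : nat)
    (B : 'I_q -> 'M[K]_n) (Z : 'I_q -> 'M[K]_r) : Prop :=
  (forall k l, comm_mx (Z k) (Z l)) /\
  (exists le_nr : (n <= r)%N,
     forall k, mxsub (widen_ord le_nr) (widen_ord le_nr) (Z k) = B k).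

Definition ce_spec (K : fieldType) (n q r : nat)
    (CE : {ffun 'I_q.+1 -> 'M[K]_n} -> {ffun 'I_q.+1 -> 'M[K]_r}) : Prop :=
  forall B : {ffun 'I_q.+1 -> 'M[K]_n},
    (3 <= q.+1)%N ->
    (forall l, l != ord0 ->
       exists m, [/\ m != ord0, m != l & H r (B ord0) (B l) (B m)]) ->
    (exists Z : {ffun 'I_q.+1 -> 'M[K]_r}, commuting_extension B Z) ->
    commuting_extension B (CE B).

Notation triple K m n p := ('rV[K]_m * 'rV[K]_n * 'rV[K]_p)%type.

Definition term (K : fieldType) (m n p : nat) (x : triple K m n p) :
    tensor K m n p :=
  outer x.1.1 x.1.2 x.2.

(* The terms returned are not required to be nonzero.  When r = 1 the
   precondition allows c_1 = 0, hence S = 0; in all other cases S has rank r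
   and the r terms are automatically nonzero. *)
Definition sd_spec (K : fieldType) (r p : nat)
    (SD : tensor K r r p -> {ffun 'I_r -> triple K r r p}) : Prop :=
  forall S : tensor K r r p,
    (exists (a b : 'I_r -> 'rV[K]_r) (c : 'I_r -> 'rV[K]_p),
       [/\ S = \sum_i outer (a i) (b i) (c i),
           free [seq a i | i : 'I_r],
           free [seq b i | i : 'I_r]
         & pairwise_independent c]) ->
    S = \sum_i term (SD S i).

(* A_i = T_1^-1 T_i for i = 2, .., p. *)
Definition normalized_slices (K : fieldType) (n q : nat)
    (T : tensor K n n q.+2) : {ffun 'I_q.+1 -> 'M[K]_n} :=
  [ffun k => invmx (slice T ord0) *m slice T (lift ord0 k)].

(* r \in [n, 4n/3] *)
Definition admissible_size (n r : nat) : bool :=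
  (n <= r)%N && (3 * r <= 4 * n)%N.

Definition algorithm2 (K : fieldType) (n q r : nat)
    (CE : {ffun 'I_q.+1 -> 'M[K]_n} -> {ffun 'I_q.+1 -> 'M[K]_r})
    (SD : tensor K r r q.+2 -> {ffun 'I_r -> triple K r r q.+2})
    (T : tensor K n n q.+2) (hr : admissible_size n r) :
    'I_r -> triple K n n q.+2 :=
  let first_n (x : 'rV[K]_r) : 'rV[K]_n :=
    colsub (widen_ord (proj1 (andP hr))) x in
  let A := normalized_slices T in
  let Z := CE A in
  let T' := tensor_of_slices
    (fun k => if unlift ord0 k is Some k' then Z k' else 1%:M) in
  let D := SD T' in
  let U' := \matrix_(i < r) first_n (D i).1.1 in
  fun i => (row i (U' *m (slice T ord0)^T), first_n (D i).1.2, (D i).2).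

(* Main.v *)
Require Import Defs.
From HB Require Import structures.
From mathcomp Require Import all_boot all_order all_fingroup all_algebra.
From mathcomp Require Import ring.
Set Implicit Arguments.
Unset Strict Implicit.
Unset Printing Implicit Defensive.
Import GRing.Theory.
Local Open Scope ring_scope.

(* With the first coefficients nonzero, T_k = U^T D_k V gives
   A_k = P Delta_k V where P V = 1, and completing P and V to inverse matrices of
   size r turns this into a simultaneously diagonalizable commuting extension of
   size r.  If Z_k has blocks A_k, B_k, C_k, D_k then
   [A_i, A_j] = B_j C_i - B_i C_j, so under (H_r) the column spaces of B_1, B_2,
   B_3 are in direct sum and Im B_1 is the intersection of Im [A_1, A_2] and
   Im [A_1, A_3].  Hence commuting extensions of size r are unique up to
   conjugation by diag(1, N), which makes every output of CE diagonalizable with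
   eigenvalues w_ik / w_i1, so that SD applies.

   The rank bound is Strassen's 2 n + rank [A_i, A_j] <= 2 s; terms with
   vanishing first coefficient are deleted one by one, each deletion lowering the
   rank of the commutator by at most 2.  For s = r equality forces T_1^-1 u_i^T
   into all three images Im [A_i, A_j] for such a term, but these have trivial
   intersection.  So all decompositions of size r have nonzero first
   coefficients, and two of them give conjugate extensions, where the conjugating
   matrix is monomial because the ratios w_ik / w_i1 separate the terms. *)

(** * One-sided inverses and their completion to square ones *)

Lemma rank_factorization (K : fieldType) (m n k : nat) (A : 'M[K]_(m, n)) :
  (\rank A <= k)%N -> exists (x : 'M_(m, k)) (y : 'M_(k, n)), A = x *m y.
Proof.
move=> leAk.
exists (col_ebase A *m pid_mx (\rank A)), (pid_mx (\rank A) *m row_ebase A).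
by rewrite mulmxA -(mulmxA (col_ebase A)) mul_pid_mx minnn (minn_idPr leAk)
  mulmx_ebase.
Qed.

(** [P] has rank [n] and kills [1 - V *m P] from the left, so the two ranks sum to at most [s]. *)
Lemma rank_complement (K : fieldType) (n s : nat) (P : 'M[K]_(n, s))
    (V : 'M[K]_(s, n)) :
  P *m V = 1%:M -> (n + \rank (1%:M - V *m P)%R <= s)%N.
Proof.
move=> PV1; have rkP : \rank P = n.
  apply/eqP; rewrite eqn_leq rank_leq_row /=.
  by rewrite -{1}(mxrank1 K n) -PV1 mxrankM_maxl.
rewrite -{1}rkP; apply: mulmx0_rank_max.
by rewrite mulmxBr mulmx1 mulmxA PV1 mul1mx subrr.
Qed.

(** The rank bound lets [1 - V *m P] factor as [x *m y] through size [k]. *)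
Lemma inverse_completion (K : fieldType) (n k : nat) (P : 'M[K]_(n, n + k))
    (V : 'M[K]_(n + k, n)) :
  P *m V = 1%:M ->
  exists (x : 'M_(n + k, k)) (y : 'M_(k, n + k)),
    row_mx V x *m col_mx P y = 1%:M.
Proof.
move=> PV1; have := rank_complement PV1; rewrite leq_add2l.
case/rank_factorization=> x [y xy]; exists x, y.
by rewrite mul_row_col -xy addrC subrK.
Qed.

(** * Commuting extensions and their uniqueness up to conjugation *)

(** Joint independence of all [3 * k] columns; matrix coefficients make it applicable to block
    equations. *)
Definition independent3 (K : fieldType) (n k : nat) (B1 B2 B3 : 'M[K]_(n, k)) :=
  forall (m : nat) (X Y W : 'M[K]_(k, m)),
    B1 *m X + B2 *m Y + B3 *m W = 0 -> [/\ X = 0, Y = 0 & W = 0].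

Lemma independent3_rank (K : fieldType) (n k : nat) (B1 B2 B3 : 'M[K]_(n, k)) :
  (3 * k <= \rank (row_mx (row_mx B1 B2) B3))%N -> independent3 B1 B2 B3.
Proof.
move=> rkB m X Y W BX0.
have free_B : row_free (row_mx (row_mx B1 B2) B3)^T.
  rewrite /row_free eqn_leq rank_leq_row mxrank_tr (leq_trans _ rkB) //.
  by rewrite !mulSn addn0 addnA.
have : col_mx (col_mx X Y) W = 0.
  apply: trmx_inj; apply: (row_free_inj free_B).
  by rewrite -trmx_mul !mul_row_col BX0 !trmx0 mul0mx.
move/eqP; rewrite !col_mx_eq0 -andbA => /and3P[/eqP-> /eqP-> /eqP->].
by split.
Qed.

(** [c] factors through the stack of [C1] and [C2], and rank [2 * k] makes that stack right
    invertible. The signs give [c *m E1 = B1] and [c *m E2 = B2]. *)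
Lemma free_col_mx_inverse (K : fieldType) (n k : nat) (c : 'M[K]_n)
    (B1 B2 : 'M[K]_(n, k)) (C1 C2 : 'M[K]_(k, n)) :
    c = B2 *m C1 - B1 *m C2 -> \rank c = (2 * k)%N ->
  exists E1 E2 : 'M[K]_(n, k),
    [/\ C1 *m E1 = 0, C2 *m E1 = - 1%:M, C1 *m E2 = 1%:M & C2 *m E2 = 0].
Proof.
move=> def_c rk_c.
have cE : c = row_mx B2 (- B1) *m col_mx C1 C2.
  by rewrite mul_row_col mulNmx.
have free_C : row_free (col_mx C1 C2).
  rewrite /row_free eqn_leq rank_leq_row /=.
  rewrite (leq_trans _ (mxrankM_maxr (row_mx B2 (- B1)) _)) //.
  by rewrite -cE rk_c mul2n addnn.
have /row_freeP[E CE1] := free_C.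
move: CE1; rewrite -[E]hsubmxK mul_col_row scalar_mx_block.
case/eq_block_mx=> e1 e2 e3 e4; exists (- rsubmx E), (lsubmx E).
by rewrite !mulmxN e1 e2 e3 e4 oppr0; split.
Qed.

Lemma comm_mx_blocks (K : fieldType) (n k : nat) (Z1 Z2 : 'M[K]_(n + k)) :
    comm_mx Z1 Z2 ->
  Defs.commutator (ulsubmx Z1) (ulsubmx Z2)
    = ursubmx Z2 *m dlsubmx Z1 - ursubmx Z1 *m dlsubmx Z2 /\
  ulsubmx Z1 *m ursubmx Z2 + ursubmx Z1 *m drsubmx Z2
    = ulsubmx Z2 *m ursubmx Z1 + ursubmx Z2 *m drsubmx Z1.
Proof.
rewrite /comm_mx -{1 2}[Z1]submxK -{1 2}[Z2]submxK !mulmx_block.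
case/eq_block_mx=> e1 e2 _ _; split=> //.
apply/eqP; rewrite /Defs.commutator subr_eq addrAC eq_sym subr_eq.
by rewrite [X in _ == X]e1 addrC.
Qed.

Lemma H_independent3 (K : fieldType) (n k : nat) (A1 A2 A3 : 'M[K]_n)
    (B1 B2 B3 : 'M[K]_(n, k)) (C1 C2 C3 : 'M[K]_(k, n)) :
    Defs.commutator A1 A2 = B2 *m C1 - B1 *m C2 ->
    Defs.commutator A1 A3 = B3 *m C1 - B1 *m C3 ->
    H (n + k) A1 A2 A3 ->
  independent3 B1 B2 B3.
Proof.
move=> c12 c13 [_ [+ _ _]]; rewrite addKn => rk3; apply: independent3_rank.
rewrite -rk3 -[X in (_ <= X)%N]mxrank_tr; apply: mxrankS.
rewrite addsmx_sub; apply/andP.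
rewrite /Im c12 c13 !tr_row_mx; split.
  apply/submxP; exists (row_mx (row_mx (- C2^T) C1^T) 0).
  by rewrite !mul_row_col mul0mx addr0 linearB /= !trmx_mul mulNmx addrC.
apply/submxP; exists (row_mx (row_mx (- C3^T) 0) C1^T).
by rewrite !mul_row_col mul0mx addr0 linearB /= !trmx_mul mulNmx addrC.
Qed.

(** Conjugation by this matrix, for invertible [N], keeps the top-left block. *)
Definition mxlift (K : fieldType) (n k : nat) (N : 'M[K]_k) : 'M[K]_(n + k) :=
  block_mx 1%:M 0 0 N.

Lemma mxlift_unit (K : fieldType) (n k : nat) (N : 'M[K]_k) :
  N \in unitmx -> mxlift n N \in unitmx.
Proof. by move=> uN; rewrite unitmxE det_lblock det1 mul1r -unitmxE. Qed.

Lemma block_conjugation (K : fieldType) (n k : nat) (Z Z' : 'M[K]_(n + k))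
    (N : 'M[K]_k) :
    ulsubmx Z' = ulsubmx Z -> ursubmx Z' = ursubmx Z *m N ->
    dlsubmx Z = N *m dlsubmx Z' -> drsubmx Z *m N = N *m drsubmx Z' ->
  mxlift n N *m Z' = Z *m mxlift n N.
Proof.
move=> eul eur edl edr; rewrite -[Z]submxK -[Z']submxK !mulmx_block.
by rewrite !mul1mx !mul0mx !mulmx1 !mulmx0 !addr0 !add0r eul eur edl edr.
Qed.

(* Only [B1 = ursubmx Z1] enters both pairs, so its column space lies in the
   intersection of [Im [A1, A2]] and [Im [A1, A3]], which the other extension
   computes to be the column space of its own block. *)
Lemma ursubmx_transfer (K : fieldType) (n k : nat) (c12 c13 : 'M[K]_n)
    (B1 B2 B3 B1' B2' B3' : 'M[K]_(n, k)) (C1 C2 C3 C1' C2' C3' : 'M[K]_(k, n)) :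
    c12 = B2 *m C1 - B1 *m C2 -> c13 = B3 *m C1 - B1 *m C3 ->
    c12 = B2' *m C1' - B1' *m C2' -> c13 = B3' *m C1' - B1' *m C3' ->
    \rank c12 = (2 * k)%N -> \rank c13 = (2 * k)%N ->
    independent3 B1 B2 B3 ->
  exists N : 'M[K]_k, B1' = B1 *m N.
Proof.
move=> e12 e13 e12' e13' rk12 rk13 indB.
have [E [_ [E1 E2 _ _]]] := free_col_mx_inverse e12' rk12.
have [F [_ [F1 F2 _ _]]] := free_col_mx_inverse e13' rk13.
have cE : c12 *m E = B1'.
  by rewrite e12' mulmxBl -!mulmxA E1 E2 mulmx0 mulmxN mulmx1 add0r opprK.
have cF : c13 *m F = B1'.
  by rewrite e13' mulmxBl -!mulmxA F1 F2 mulmx0 mulmxN mulmx1 add0r opprK.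
have : B1 *m (C3 *m F - C2 *m E) + B2 *m (C1 *m E) + B3 *m (- (C1 *m F)) = 0.
  have : c12 *m E = c13 *m F by rewrite cE cF.
  rewrite e12 e13 !mulmxBl -!mulmxA mulmxBr mulmxN.
  move: (B1 *m _) (B1 *m _) (B2 *m _) (B3 *m _) => a b c d /eqP.
  rewrite subr_eq => /eqP->; rewrite addrAC addrC -!addrA.
  by apply/matrixP=> i j; rewrite !mxE; ring.
case/indB=> _ C1E0 _; exists (- (C2 *m E)).
by rewrite -cE e12 mulmxBl -!mulmxA C1E0 mulmx0 sub0r mulmxN.
Qed.

Lemma drsubmx_transfer (K : fieldType) (n k : nat)
    (Z1 Z2 Z1' Z2' : 'M[K]_(n + k)) (N : 'M[K]_k) :
    comm_mx Z1 Z2 -> comm_mx Z1' Z2' ->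
    ulsubmx Z1' = ulsubmx Z1 -> ulsubmx Z2' = ulsubmx Z2 ->
    ursubmx Z1' = ursubmx Z1 *m N -> ursubmx Z2' = ursubmx Z2 *m N ->
    (forall X Y : 'M[K]_k,
       ursubmx Z1 *m X + ursubmx Z2 *m Y = 0 -> X = 0 /\ Y = 0) ->
  drsubmx Z1 *m N = N *m drsubmx Z1' /\ drsubmx Z2 *m N = N *m drsubmx Z2'.
Proof.
move=> /comm_mx_blocks[_ e] /comm_mx_blocks[_ e'] A1 A2 B1 B2 inj.
have [] := inj (drsubmx Z2 *m N - N *m drsubmx Z2')
  (N *m drsubmx Z1' - drsubmx Z1 *m N).
  rewrite !mulmxBr; move: (congr1 (mulmx^~ N) e) e' => /=.
  rewrite A1 A2 B1 B2 !mulmxDl -!mulmxA.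
  move: (ulsubmx Z1 *m _) (ulsubmx Z2 *m _) => a1 a2.
  move: (ursubmx Z1 *m _) (ursubmx Z1 *m _) (ursubmx Z2 *m _) (ursubmx Z2 *m _).
  move=> a b c d e1 e2.
  apply: etrans (_ : (a1 + b) - (a2 + d) - ((a1 + a) - (a2 + c)) = 0).
    by apply/matrixP=> i j; rewrite !mxE; ring.
  by rewrite e1 e2 !subrr.
by move=> /eqP; rewrite subr_eq0 => /eqP-> /eqP; rewrite subr_eq0 => /eqP->.
Qed.

Lemma independent3_rot (K : fieldType) (n k : nat) (B1 B2 B3 : 'M[K]_(n, k)) :
  independent3 B1 B2 B3 -> independent3 B2 B3 B1.
Proof.
move=> ind m X Y W BX0; have [//|-> -> ->] := ind m W X Y; last by [].
by rewrite -addrA addrC.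
Qed.

(** Each top-right block gets its own factor; the lower-left blocks then force the three factors to
    agree. Independence later identifies the [N] of different triples. *)
Lemma conjugate_extensions3 (K : fieldType) (n k : nat)
    (Z1 Z2 Z3 Z1' Z2' Z3' : 'M[K]_(n + k)) :
    comm_mx Z1 Z2 -> comm_mx Z1 Z3 -> comm_mx Z2 Z3 ->
    comm_mx Z1' Z2' -> comm_mx Z1' Z3' -> comm_mx Z2' Z3' ->
    ulsubmx Z1' = ulsubmx Z1 -> ulsubmx Z2' = ulsubmx Z2 ->
    ulsubmx Z3' = ulsubmx Z3 ->
    H (n + k) (ulsubmx Z1) (ulsubmx Z2) (ulsubmx Z3) ->
  exists N : 'M[K]_k,
    [/\ N \in unitmx, independent3 (ursubmx Z1) (ursubmx Z2) (ursubmx Z3),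
        mxlift n N *m Z1' = Z1 *m mxlift n N
      & mxlift n N *m Z2' = Z2 *m mxlift n N].
Proof.
move=> z12 z13 z23 z12' z13' z23' A1 A2 A3 HA.
have [[]] := HA; rewrite addKn /Im !mxrank_tr => rk12 rk13 rk23 _.
have [c12 _] := comm_mx_blocks z12; have [c13 _] := comm_mx_blocks z13.
have [c23 _] := comm_mx_blocks z23; have := comm_mx_blocks z12'.
have := comm_mx_blocks z13'; have := comm_mx_blocks z23'.
rewrite A1 A2 A3 => -[c23' _] [c13' _] [c12' _].
have indB := H_independent3 c12 c13 HA.
have indB' := H_independent3 c12' c13' HA.
have [N1 B1] := ursubmx_transfer c12 c13 c12' c13' rk12 rk13 indB.
have [M1 B1'] := ursubmx_transfer c12' c13' c12 c13 rk12 rk13 indB'.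
(* The transfer lemma concerns one block; rotating the triple, with commutators negated where the
   order flips, handles the other two. *)
have rk21 := etrans (mxrank_opp _) rk12.
have rk31 := etrans (mxrank_opp _) rk13.
have rk32 := etrans (mxrank_opp _) rk23.
have neg (X a b : 'M[K]_n) : X = a - b -> - X = b - a by move->; rewrite opprB.
have [N2 B2] := ursubmx_transfer c23 (neg _ _ _ c12) c23' (neg _ _ _ c12')
  rk23 rk21 (independent3_rot indB).
have [N3 B3] := ursubmx_transfer (neg _ _ _ c13) (neg _ _ _ c23)
  (neg _ _ _ c13') (neg _ _ _ c23') rk31 rk32
  (independent3_rot (independent3_rot indB)).
(* [M1] comes from exchanging the two extensions; independent columns make it inverse to [N1]. *)
have M1N1 : N1 *m M1 = 1%:M.
  have [|/eqP] := indB _ (1%:M - N1 *m M1) 0 0; last by rewrite subr_eq0 => /eqP.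
  by rewrite !mulmx0 !addr0 mulmxBr mulmx1 mulmxA -B1 -B1' subrr.
(* Comparing coefficients in one commutator, each lower-left block acquires the factor of the other
   index. *)
have match_C (Bi Bj Bi' Bj' : 'M[K]_(n, k)) (Ci Cj Ci' Cj' : 'M[K]_(k, n))
    (Ni Nj : 'M[K]_k) c :
    c = Bj *m Ci - Bi *m Cj -> c = Bj' *m Ci' - Bi' *m Cj' ->
    Bi' = Bi *m Ni -> Bj' = Bj *m Nj ->
    (forall m (X Y : 'M[K]_(k, m)), Bi *m X + Bj *m Y = 0 -> X = 0 /\ Y = 0) ->
    Ci = Nj *m Ci' /\ Cj = Ni *m Cj'.
  move=> -> + eBi eBj inj; rewrite eBi eBj -!mulmxA => e.
  have [] := inj _ (Ni *m Cj' - Cj) (Ci - Nj *m Ci').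
    apply: etrans (_ : (Bj *m Ci - Bi *m Cj)
      - (Bj *m (Nj *m Ci') - Bi *m (Ni *m Cj')) = 0); last by rewrite e subrr.
    rewrite !mulmxBr opprB.
    by rewrite addrC [X in _ + X = _]addrC addrACA [X in _ + X = _]addrC.
  by move=> /eqP; rewrite subr_eq0 => /eqP-> /eqP; rewrite subr_eq0 => /eqP->.
have ind12 m (X Y : 'M[K]_(k, m)) :
    ursubmx Z1 *m X + ursubmx Z2 *m Y = 0 -> X = 0 /\ Y = 0.
  by move=> e; have [|-> ->] := indB _ X Y 0; rewrite ?mulmx0 ?addr0.
have ind13 m (X Y : 'M[K]_(k, m)) :
    ursubmx Z1 *m X + ursubmx Z3 *m Y = 0 -> X = 0 /\ Y = 0.
  by move=> e; have [|-> _ ->] := indB _ X 0 Y; rewrite ?mulmx0 ?addr0.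
have ind23 m (X Y : 'M[K]_(k, m)) :
    ursubmx Z2 *m X + ursubmx Z3 *m Y = 0 -> X = 0 /\ Y = 0.
  by move=> e; have [|_ -> ->] := indB _ 0 X Y; rewrite ?mulmx0 ?add0r.
have [C1 C2] := match_C _ _ _ _ _ _ _ _ _ _ _ c12 c12' B1 B2 ind12.
have [C1_ C3] := match_C _ _ _ _ _ _ _ _ _ _ _ c13 c13' B1 B3 ind13.
have [C2_ _] := match_C _ _ _ _ _ _ _ _ _ _ _ c23 c23' B2 B3 ind23.
(* Two pairs give the lower-left block of [Z2] the factors [N1] and [N3], and that of [Z1] the
   factors [N2] and [N3]; right inverses of the primed blocks cancel the rest. *)
have [_ [F [_ _ C2F _]]] := free_col_mx_inverse c23' rk23.
have [_ [G [_ _ C1G _]]] := free_col_mx_inverse c12' rk12.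
have N13 : N1 = N3.
  by rewrite -[N1]mulmx1 -C2F mulmxA -C2 C2_ -mulmxA C2F mulmx1.
have N21 : N2 = N1.
  by rewrite N13 -[N2]mulmx1 -C1G mulmxA -C1 C1_ -mulmxA C1G mulmx1.
rewrite N21 in B2 C1.
have [D1 D2] := drsubmx_transfer z12 z12' A1 A2 B1 B2 (ind12 _).
exists N1; split=> //; first by case/mulmx1_unit: M1N1.
  exact: block_conjugation.
exact: block_conjugation.
Qed.

Lemma mxlift_ursubmx (K : fieldType) (n k : nat) (Z Z' : 'M[K]_(n + k))
    (N : 'M[K]_k) :
  mxlift n N *m Z' = Z *m mxlift n N -> ursubmx Z' = ursubmx Z *m N.
Proof.
rewrite -{1}[Z]submxK -{1}[Z']submxK !mulmx_block => /eq_block_mx[_ + _ _].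
by rewrite mul1mx mul0mx mulmx0 addr0 add0r.
Qed.

Lemma conjugate_extensions (K : fieldType) (n k q : nat)
    (Z Z' : 'I_q.+1 -> 'M[K]_(n + k)) :
    (0 < q)%N ->
    (forall i j, comm_mx (Z i) (Z j)) -> (forall i j, comm_mx (Z' i) (Z' j)) ->
    (forall i, ulsubmx (Z' i) = ulsubmx (Z i)) ->
    (forall l, l != ord0 -> exists m, [/\ m != ord0, m != l &
       H (n + k) (ulsubmx (Z ord0)) (ulsubmx (Z l)) (ulsubmx (Z m))]) ->
  exists2 N : 'M[K]_k, N \in unitmx &
    forall l, mxlift n N *m Z' l = Z l *m mxlift n N.
Proof.
move=> q_gt0 cZ cZ' eA HA.
have conj3 l : l != ord0 -> exists N : 'M[K]_k, [/\ N \in unitmx,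
    forall X : 'M_k, ursubmx (Z ord0) *m X = 0 -> X = 0,
    mxlift n N *m Z' ord0 = Z ord0 *m mxlift n N
  & mxlift n N *m Z' l = Z l *m mxlift n N].
  move=> /HA[m [_ _ HAm]].
  have [N [uN ind e0 el]] := conjugate_extensions3 (cZ _ _) (cZ _ _) (cZ _ _)
    (cZ' _ _) (cZ' _ _) (cZ' _ _) (eA _) (eA _) (eA _) HAm.
  exists N; split=> // X BX0.
  by have [|-> _ _] := ind _ X 0 0; rewrite ?mulmx0 ?addr0.
have [N [uN inj e0 _]] := conj3 (lift ord0 (Ordinal q_gt0)) isT.
exists N => // l; have [->//|/conj3[N' [_ _ e0' el]]] := eqVneq l ord0.
(* Both factors send the top-right block of [Z ord0] to that of [Z' ord0]. *)
suff -> : N = N' by [].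
apply/eqP; rewrite -subr_eq0; apply/eqP/inj.
by rewrite mulmxBr -(mxlift_ursubmx e0) -(mxlift_ursubmx e0') subrr.
Qed.

(** * Intersections of commutator images and intertwiners of diagonal matrices *)

(** Each image lies in the sum of two of three independent spaces, and the three such sums meet only
    in 0. *)
Lemma commutator_image_inter (K : fieldType) (n k : nat)
    (c12 c13 c23 : 'M[K]_n) (B1 B2 B3 : 'M[K]_(n, k)) (C1 C2 C3 : 'M[K]_(k, n))
    (x : 'cV[K]_n) :
    c12 = B2 *m C1 - B1 *m C2 -> c13 = B3 *m C1 - B1 *m C3 ->
    c23 = B3 *m C2 - B2 *m C3 -> independent3 B1 B2 B3 ->
    (x^T <= Im c12)%MS -> (x^T <= Im c13)%MS -> (x^T <= Im c23)%MS ->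
  x = 0.
Proof.
have imE (c : 'M[K]_n) : (x^T <= Im c)%MS -> exists y : 'cV_n, x = c *m y.
  by case/submxP=> D e; exists D^T; apply: trmx_inj; rewrite trmx_mul trmxK.
move=> -> -> -> ind /imE[y ey] /imE[y' ey'] /imE[y'' ey''].
move: ey ey' ey''; rewrite !mulmxBl -!mulmxA => ey ey' ey''.
have [|_ C1y0 _] := ind _ (C3 *m y' - C2 *m y) (C1 *m y) (- (C1 *m y')).
  apply: etrans (_ : B2 *m (C1 *m y) - B1 *m (C2 *m y)
    - (B3 *m (C1 *m y') - B1 *m (C3 *m y')) = 0); last by rewrite -ey -ey' subrr.
  rewrite mulmxBr mulmxN.
  move: (B1 *m _) (B1 *m _) (B2 *m _) (B3 *m _) => b b' c d.
  by apply/matrixP=> i j; rewrite !mxE; ring.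
have [|C2y0 _ _] := ind _ (- (C2 *m y)) (C1 *m y + C3 *m y'') (- (C2 *m y'')).
  apply: etrans (_ : B2 *m (C1 *m y) - B1 *m (C2 *m y)
    - (B3 *m (C2 *m y'') - B2 *m (C3 *m y'')) = 0); last by rewrite -ey -ey'' subrr.
  rewrite mulmxDr !mulmxN.
  move: (B1 *m _) (B2 *m _) (B2 *m _) (B3 *m _) => b c c' d.
  by apply/matrixP=> i j; rewrite !mxE; ring.
rewrite ey C1y0; move/eqP: C2y0; rewrite oppr_eq0 => /eqP->.
by rewrite !mulmx0 subrr.
Qed.

(** [G i j] is nonzero only where [d' k 0 j = d k 0 i] for every [k]; since [d] separates indices,
    each column of [G] has at most one nonzero entry. *)
Lemma monomial_intertwiner (K : fieldType) (r q : nat) (d d' : 'I_q -> 'rV[K]_r)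
    (G : 'M[K]_r) :
    G \in unitmx ->
    (forall k, G *m diag_mx (d' k) = diag_mx (d k) *m G) ->
    (forall i j, (forall k, d k 0 i = d k 0 j) -> i = j) ->
  exists s : 'S_r,
    (forall i k, d' k 0 (s i) = d k 0 i) /\ (forall i j, j != s i -> G i j = 0).
Proof.
move=> uG GdG inj_d.
have dE i j k : G i j != 0 -> d' k 0 j = d k 0 i.
  move=> Gij; have /matrixP/(_ i j) := GdG k.
  by rewrite mul_mx_diag mul_diag_mx !mxE [RHS]mulrC => /(mulfI Gij).
(* Some term of the determinant expansion is nonzero. *)
have /existsP[s /forallP Gs] : [exists s : 'S_r, [forall i, G i (s i) != 0]].
  apply: contraTT uG; rewrite negb_exists => /forallP G0.
  rewrite unitmxE unitfE negbK; apply/eqP/big1 => s _.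
  move: (G0 s); rewrite negb_forall => /existsP[i]; rewrite negbK => /eqP Gi0.
  by rewrite (bigD1 i) //= Gi0 mul0r mulr0.
exists s; split=> [i k|i j js]; first exact: dE.
apply/eqP; apply: contraNT js => Gij; rewrite -(permKV s j) (inj_eq perm_inj).
apply/eqP/inj_d => k.
by rewrite -(dE _ _ k Gij) -(dE _ _ k (Gs _)) permKV.
Qed.

(** * Strassen's commutator bound and its equality case *)

(** With [V *m P] written as [1 - E], the commuting diagonal parts cancel and two products through
    [E] remain, each of rank at most [s - n]. *)
Lemma commutator_rank (K : fieldType) (n s : nat) (P : 'M[K]_(n, s))
    (V : 'M[K]_(s, n)) (d e : 'rV[K]_s) :
    P *m V = 1%:M ->
  (2 * n + \rank (Defs.commutator (P *m diag_mx d *m V) (P *m diag_mx e *m V))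
     <= 2 * s)%N.
Proof.
move=> PV1; have rkE := rank_complement PV1; set E := 1%:M - V *m P in rkE.
have VP : V *m P = 1%:M - E by rewrite opprB addrC subrK.
have prodE a b : P *m diag_mx a *m V *m (P *m diag_mx b *m V) =
    P *m (diag_mx a *m diag_mx b) *m V - P *m diag_mx a *m E *m (diag_mx b *m V).
  by rewrite -!mulmxA [V *m (P *m _)]mulmxA VP !(mulmxBl, mulmxBr) mul1mx !mulmxA.
rewrite /Defs.commutator !prodE (diag_mx_comm e d) opprB addrC addrA addrNK.
have bound a b : (\rank (P *m diag_mx a *m E *m (diag_mx b *m V)) <= \rank E)%N.
  exact: leq_trans (mxrankM_maxl _ _) (mxrankM_maxr _ _).
rewrite -(leq_pmul2l (isT : 0 < 2)%N) mulnDr in rkE.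
apply: leq_trans rkE; rewrite leq_add2l mul2n -addnn addrC.
apply: leq_trans (mxrank_add _ _) _; rewrite mxrank_opp.
exact: leq_add.
Qed.

(** With the [k]-th coordinates of [w] as coefficients this is the [k]-th slice of the sum of outer
    products. *)
Definition lincomb (K : fieldType) (n s : nat) (u v : 'I_s -> 'rV[K]_n)
    (a : 'I_s -> K) : 'M[K]_n :=
  \sum_i a i *: ((u i)^T *m v i).

Lemma lincombE (K : fieldType) (n s : nat) (u v : 'I_s -> 'rV[K]_n)
    (a : 'I_s -> K) :
  lincomb u v a
    = \matrix_(j, i) u i 0 j *m diag_mx (\row_i a i) *m \matrix_i v i.
Proof.
rewrite mul_mx_diag; apply/matrixP=> i j; rewrite /lincomb summxE !mxE.
apply: eq_bigr => l _; rewrite !mxE big_ord1 !mxE mulrA.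
by congr (_ * _); rewrite mulrC.
Qed.

(** Invertibility of the combination makes [P] a left inverse of the matrix of the [v i]. The
    columns of [P] determine the [u i], so these can be read off an extension. *)
Lemma lincomb_factor (K : fieldType) (n s : nat) (u v : 'I_s -> 'rV[K]_n)
    (a : 'I_s -> K) :
    (forall i, a i != 0) -> lincomb u v a \in unitmx ->
  exists P : 'M[K]_(n, s),
    [/\ P *m \matrix_i v i = 1%:M,
        forall b, invmx (lincomb u v a) *m lincomb u v b
          = P *m diag_mx (\row_i (b i / a i)) *m \matrix_i v i
      & forall i, lincomb u v a *m col i P = a i *: (u i)^T].
Proof.
move=> a0 uS; pose P := invmx (lincomb u v a) *m \matrix_(j, i) u i 0 j
  *m diag_mx (\row_i a i).
have PE b : invmx (lincomb u v a) *m lincomb u v b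
    = P *m diag_mx (\row_i (b i / a i)) *m \matrix_i v i.
  rewrite (lincombE u v b) /P !mulmxA -[in RHS](mulmxA _ (diag_mx _) (diag_mx _)).
  rewrite mulmx_diag; congr (_ *m diag_mx _ *m _).
  by apply/rowP=> i; rewrite !mxE mulrC divfK.
exists P; split=> // [|i].
  rewrite -(mulVmx uS) PE; congr (_ *m _); rewrite -[LHS]mulmx1; congr (_ *m _).
  by rewrite -diag_const_mx; congr diag_mx; apply/rowP=> i; rewrite !mxE divff.
rewrite colE mulmxA -colE /P -mulmxA mulKVmx // mul_mx_diag.
by apply/matrixP=> j j'; rewrite !mxE !ord1 mulrC.
Qed.

(** The terms quadratic in [x *m v] cancel; every other new term starts with [x] or ends with
    [v]. *)
Lemma commutator_update (K : fieldType) (n : nat) (M M' : 'M[K]_n)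
    (x : 'cV[K]_n) (v : 'rV[K]_n) (b c : K) :
  exists (al : 'rV[K]_n) (be : 'cV[K]_n),
    Defs.commutator (M + b *: (x *m v)) (M' + c *: (x *m v))
      = Defs.commutator M M' + x *m al + be *m v.
Proof.
exists (b *: (v *m (M' + c *: (x *m v))) - c *: (v *m (M + b *: (x *m v)))).
exists (c *: (M *m x) - b *: (M' *m x)).
rewrite /Defs.commutator !(mulmxDl, mulmxDr, mulmxBl, mulmxBr, mulmxN, mulNmx,
  =^~ scalemxAl, =^~ scalemxAr, scalerDr, mulmxA).
move: (x *m v *m x *m v) (x *m v *m M) (x *m v *m M') (M *m M') (M' *m M).
move: (M *m x *m v) (M' *m x *m v) => A1 A2 A3 A4 A5 A6 A7.
by apply/matrixP=> i j; rewrite !mxE; ring.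
Qed.

Lemma lincomb_removal (K : fieldType) (n s : nat) (u v : 'I_s.+1 -> 'rV[K]_n)
    (i0 : 'I_s.+1) (a : 'I_s.+1 -> K) :
  lincomb u v a = lincomb (u \o lift i0) (v \o lift i0) (a \o lift i0)
    + a i0 *: ((u i0)^T *m v i0).
Proof. by rewrite /lincomb (bigD1_ord i0) //= addrC. Qed.

(** Written in coefficients alone, so that terms can be deleted in an induction. *)
Definition normalized_lincomb (K : fieldType) (n s : nat)
    (u v : 'I_s -> 'rV[K]_n) (a b : 'I_s -> K) : 'M[K]_n :=
  invmx (lincomb u v a) *m lincomb u v b.

(* Deleting a term with vanishing first coefficient changes the commutator by
   two rank-one matrices, one of which has column space spanned by that term. *)
Lemma commutator_removal (K : fieldType) (n s : nat)
    (u v : 'I_s.+1 -> 'rV[K]_n) (i0 : 'I_s.+1) (a b c : 'I_s.+1 -> K) :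
    a i0 = 0 ->
  let A := normalized_lincomb u v a in
  let A' d := normalized_lincomb (u \o lift i0) (v \o lift i0)
    (a \o lift i0) (d \o lift i0) in
  exists be : 'rV[K]_n,
    (Im (Defs.commutator (A b) (A c)) <=
      Im (Defs.commutator (A' b) (A' c))
      + ((invmx (lincomb u v a) *m (u i0)^T)^T + be))%MS.
Proof.
move=> a0 /=; rewrite /normalized_lincomb.
have Sa : lincomb u v a
    = lincomb (u \o lift i0) (v \o lift i0) (a \o lift i0).
  by rewrite (lincomb_removal u v i0 a) a0 scale0r addr0.
rewrite -Sa (lincomb_removal u v i0 b) (lincomb_removal u v i0 c) !mulmxDr.
rewrite -!scalemxAr !mulmxA.
set M := _ *m lincomb _ _ _; set M' := _ *m lincomb _ _ (c \o _).
have [al [be ->]] := commutator_update M M' (invmx (lincomb u v a) *m (u i0)^T)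
  (v i0) (b i0) (c i0).
exists be^T; rewrite /Im !linearD /= (trmx_mul _ al) (trmx_mul be).
by rewrite -addrA addmx_sub_adds // addmx_sub_adds ?submxMl.
Qed.

Lemma rank_addsmx_row2 (K : fieldType) (m n : nat) (A : 'M[K]_(m, n))
    (x y : 'rV[K]_n) :
  (\rank (A + (x + y))%MS <= \rank A + 2)%N.
Proof.
apply: leq_trans (mxrank_adds_leqif _ _) _; rewrite leq_add2l.
apply: leq_trans (mxrank_adds_leqif _ _) _.
by rewrite (leq_add (rank_leq_row x) (rank_leq_row y)).
Qed.

Lemma lincomb_unit_removal (K : fieldType) (n s : nat)
    (u v : 'I_s.+1 -> 'rV[K]_n) (i0 : 'I_s.+1) (a : 'I_s.+1 -> K) :
    a i0 = 0 -> lincomb u v a \in unitmx ->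
  lincomb (u \o lift i0) (v \o lift i0) (a \o lift i0) \in unitmx.
Proof. by move=> a0; rewrite (lincomb_removal u v i0 a) a0 scale0r addr0. Qed.

(** Deleting a term with [a i = 0] keeps [lincomb u v a], lowers [2 * s] by 2 and the rank by at
    most 2; once no such term is left, the diagonal case applies. *)
Lemma commutator_bound (K : fieldType) (n s : nat) (u v : 'I_s -> 'rV[K]_n)
    (a b c : 'I_s -> K) :
    lincomb u v a \in unitmx ->
  (2 * n + \rank (Defs.commutator (normalized_lincomb u v a b)
                                  (normalized_lincomb u v a c)) <= 2 * s)%N.
Proof.
elim: s u v a b c => [|s IHs] u v a b c uS;
    have [/forallP a0|] := boolP [forall i, a i != 0].
- have [P [PV1 PE _]] := lincomb_factor a0 uS; rewrite /normalized_lincomb !PE.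
  exact: commutator_rank.
- by rewrite negb_forall => /existsP[[]].
- have [P [PV1 PE _]] := lincomb_factor a0 uS; rewrite /normalized_lincomb !PE.
  exact: commutator_rank.
rewrite negb_forall => /existsP[i0]; rewrite negbK => /eqP ai0.
have [be /mxrankS sub] := commutator_removal u v b c ai0.
have := IHs _ _ _ (b \o lift i0) (c \o lift i0) (lincomb_unit_removal ai0 uS).
rewrite -(leq_add2r 2) -addnA -mulnSr; apply: leq_trans; rewrite leq_add2l.
rewrite -mxrank_tr; apply: leq_trans sub _.
by rewrite (leq_trans (rank_addsmx_row2 _ _ _)) // /Im mxrank_tr.
Qed.

(** The bound for the other [s - 1] terms turns the inclusion obtained by deleting term [i0] into an
    equality of spaces, and the larger space contains this vector. *)
Lemma zero_coef_image (K : fieldType) (n s : nat) (u v : 'I_s -> 'rV[K]_n)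
    (i0 : 'I_s) (a b c : 'I_s -> K) :
    a i0 = 0 -> lincomb u v a \in unitmx ->
    let A := normalized_lincomb u v a in
    (2 * s <= 2 * n + \rank (Defs.commutator (A b) (A c)))%N ->
  ((invmx (lincomb u v a) *m (u i0)^T)^T <= Im (Defs.commutator (A b) (A c)))%MS.
Proof.
case: s u v i0 a b c => [u v [] //|s] u v i0 a b c ai0 uS /= rk.
have [be sub] := commutator_removal u v b c ai0.
have := commutator_bound (b \o lift i0) (c \o lift i0)
  (lincomb_unit_removal ai0 uS).
rewrite -(leq_add2r 2) -mulnSr -addnA => /leq_trans/(_ rk).
rewrite leq_add2l => le_rk.
have [_ /esym] := mxrank_leqif_eq sub; rewrite eqn_leq mxrankS //=.
rewrite (leq_trans (rank_addsmx_row2 _ _ _)) /Im ?mxrank_tr //.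
case/andP=> _; apply: submx_trans.
exact: submx_trans (addsmxSl _ _) (addsmxSr _ _).
Qed.

(** * Slices of sums of outer products, and coefficient ratios *)

Lemma free_rows (K : fieldType) (m n : nat) (A : 'M[K]_(m, n))
    (a : 'I_m -> 'rV[K]_n) :
  row_free A -> (forall i, a i = row i A) -> free [seq a i | i : 'I_m].
Proof.
move=> free_A aE; have -> : [seq a i | i : 'I_m] = [tuple a i | i < m] by [].
apply/freeP=> c c0 i; suff /rowP/(_ i) : \row_j c j = 0 by rewrite !mxE.
apply: (row_free_inj free_A); rewrite mul0mx mulmx_sum_row -[RHS]c0.
by apply: eq_bigr => j _; rewrite mxE nth_mktuple aE.
Qed.

Lemma slice_inj (K : fieldType) (m n p : nat) (S T : tensor K m n p) :
  (forall k, slice S k = slice T k) -> S = T.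
Proof.
move=> eST; apply/ffunP=> -[[i j] k].
by have /matrixP/(_ i j) := eST k; rewrite !mxE.
Qed.

Lemma slice_outer (K : fieldType) (m n p : nat) (u : 'rV[K]_m) (v : 'rV[K]_n)
    (w : 'rV[K]_p) (k : 'I_p) :
  slice (outer u v w) k = w 0 k *: (u^T *m v).
Proof.
by apply/matrixP=> i j; rewrite !mxE ffunE big_ord1 !mxE /= mulrC.
Qed.

Lemma slice_sum (K : fieldType) (m n p s : nat) (t : 'I_s -> tensor K m n p)
    (k : 'I_p) :
  slice (\sum_i t i) k = \sum_i slice (t i) k.
Proof.
apply/matrixP=> i j; rewrite !mxE sum_ffunE summxE.
by apply: eq_bigr => l _; rewrite mxE.
Qed.

Lemma slice_sum_outer (K : fieldType) (n p s : nat) (u v : 'I_s -> 'rV[K]_n)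
    (w : 'I_s -> 'rV[K]_p) (k : 'I_p) :
  slice (\sum_i outer (u i) (v i) (w i)) k = lincomb u v (fun i => w i 0 k).
Proof. by rewrite slice_sum; apply: eq_bigr => i _; rewrite slice_outer. Qed.

Lemma slice_of_slices (K : fieldType) (m n p : nat) (M : 'I_p -> 'M[K]_(m, n))
    (k : 'I_p) :
  slice (tensor_of_slices M) k = M k.
Proof. by apply/matrixP=> i j; rewrite mxE ffunE. Qed.

Lemma normalized_slices_sum (K : fieldType) (n q s : nat)
    (u v : 'I_s -> 'rV[K]_n) (w : 'I_s -> 'rV[K]_q.+2) (l : 'I_q.+1) :
  normalized_slices (\sum_i outer (u i) (v i) (w i)) l
    = normalized_lincomb u v (fun i => w i 0 ord0) (fun i => w i 0 (lift ord0 l)).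
Proof. by rewrite ffunE !slice_sum_outer. Qed.

Definition ratio (K : fieldType) (q s : nat) (w : 'I_s -> 'rV[K]_q.+2)
    (l : 'I_q.+1) : 'rV[K]_s :=
  \row_i (w i 0 (lift ord0 l) / w i 0 ord0).

Lemma ratio_inj (K : fieldType) (q s : nat) (w : 'I_s -> 'rV[K]_q.+2) :
    pairwise_independent w -> (forall i, w i 0 ord0 != 0) ->
  forall i j, (forall l, ratio w l 0 i = ratio w l 0 j) -> i = j.
Proof.
move=> ind w0 i j eij; apply/eqP; apply: contraT => /ind.
rewrite free_cons span_seq1 => /andP[/negP nin _]; case: nin; apply/vlineP.
exists (w i 0 ord0 / w j 0 ord0); apply/rowP=> k; rewrite !mxE.
case: (unliftP ord0 k) => [l ->|->]; last by rewrite divfK.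
have := eij l; rewrite !mxE => /(canRL (divfK (w0 i))) ->.
by rewrite mulrAC [RHS]mulrAC [X in _ = X / _]mulrC.
Qed.

Lemma size_bound (K : fieldType) (n q s : nat) (u v : 'I_s -> 'rV[K]_n)
    (w : 'I_s -> 'rV[K]_q.+2) :
    slice (\sum_i outer (u i) (v i) (w i)) ord0 \in unitmx ->
  (n <= s)%N.
Proof.
(* The zero coefficients are placeholders: the rank term is dropped. *)
rewrite slice_sum_outer => /commutator_bound-/(_ (fun=> 0) (fun=> 0)).
by move/(leq_trans (leq_addr _ _)); rewrite leq_pmul2l.
Qed.

(** * Extensions built from decompositions, and uniqueness *)

(** [Q] and [R] complete [P] and the matrix of the [v i] to inverse matrices. The last two clauses
    allow the factors to be recovered. *)
Lemma diagonal_extension (K : fieldType) (n k q : nat)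
    (u v : 'I_(n + k) -> 'rV[K]_n) (w : 'I_(n + k) -> 'rV[K]_q.+2)
    (T : tensor K n n q.+2) :
    T = \sum_i outer (u i) (v i) (w i) -> (forall i, w i 0 ord0 != 0) ->
    slice T ord0 \in unitmx ->
  exists Q R : 'M[K]_(n + k),
    [/\ Q *m R = 1%:M,
        forall l, ulsubmx (Q *m diag_mx (ratio w l) *m R) = normalized_slices T l,
        lsubmx R = \matrix_i v i
      & forall i, slice T ord0 *m col i (usubmx Q) = w i 0 ord0 *: (u i)^T].
Proof.
move=> -> w0 uT; rewrite slice_sum_outer in uT *.
have [P [PV1 PE PuE]] := lincomb_factor w0 uT.
have [x [y RQ1]] := inverse_completion PV1.
exists (col_mx P y), (row_mx (\matrix_i v i) x); split.
- exact: mulmx1C.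
- move=> l; rewrite normalized_slices_sum /normalized_lincomb PE.
  rewrite -mulmxA mul_col_mx -mulmxA mul_mx_row /ulsubmx.
  by rewrite col_mxKu mul_mx_row row_mxKl mulmxA.
- by rewrite row_mxKl.
by rewrite col_mxKu.
Qed.

Lemma diagonal_conjugates_commute (K : fieldType) (r : nat) (Q R : 'M[K]_r)
    (d e : 'rV[K]_r) :
  Q *m R = 1%:M ->
  comm_mx (Q *m diag_mx d *m R) (Q *m diag_mx e *m R).
Proof.
move=> /mulmx1C RQ1.
have prodE a b : Q *m diag_mx a *m R *m (Q *m diag_mx b *m R)
    = Q *m (diag_mx a *m diag_mx b) *m R.
  by rewrite -!mulmxA [R *m (Q *m _)]mulmxA RQ1 mul1mx.
by rewrite /comm_mx !prodE diag_mx_comm.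
Qed.

Lemma outer0l (K : fieldType) (m n p : nat) (v : 'rV[K]_n) (w : 'rV[K]_p) :
  outer (0 : 'rV[K]_m) v w = 0.
Proof. by apply/ffunP=> x; rewrite !ffunE mxE !mul0r. Qed.

Lemma first_coef_neq0 (K : fieldType) (n k q : nat)
    (u v u' v' : 'I_(n + k) -> 'rV[K]_n) (w w' : 'I_(n + k) -> 'rV[K]_q.+2)
    (T : tensor K n n q.+2) (a b c : 'I_q.+1) (i : 'I_(n + k)) :
    T = \sum_i outer (u i) (v i) (w i) -> (forall i, w i 0 ord0 != 0) ->
    T = \sum_i outer (u' i) (v' i) (w' i) ->
    slice T ord0 \in unitmx ->
    H (n + k) (normalized_slices T a) (normalized_slices T b)
      (normalized_slices T c) ->
    outer (u' i) (v' i) (w' i) != 0 ->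
  w' i 0 ord0 != 0.
Proof.
move=> Tuvw w0 Tuvw' uT HT; apply: contra_neq => w'i0.
suff -> : u' i = 0 by rewrite outer0l.
suff: invmx (slice T ord0) *m (u' i)^T = 0.
  by move/(congr1 (mulmx (slice T ord0))); rewrite mulKVmx // mulmx0
    => /(congr1 trmx); rewrite trmxK trmx0.
(* The independent blocks come from the unprimed decomposition. *)
have [Q [R [QR1 ulE _ _]]] := diagonal_extension Tuvw w0 uT.
have comm l l' := diagonal_conjugates_commute (ratio w l) (ratio w l') QR1.
have := comm_mx_blocks (comm b c); have := comm_mx_blocks (comm a c).
have := comm_mx_blocks (comm a b); rewrite !ulE => -[cab _] [cac _] [cbc _].
have ind := H_independent3 cab cac HT.
have [[]] := HT; rewrite addKn /Im !mxrank_tr => rkab rkac rkbc _.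
(* The primed decomposition attains equality in the rank bound. *)
have image l l' : \rank (Defs.commutator (normalized_slices T l)
      (normalized_slices T l')) = (2 * k)%N ->
    ((invmx (slice T ord0) *m (u' i)^T)^T
       <= Im (Defs.commutator (normalized_slices T l) (normalized_slices T l')))%MS.
  move: uT; rewrite Tuvw' !normalized_slices_sum slice_sum_outer => uS rk.
  by apply: zero_coef_image; rewrite // rk mulnDr.
by apply: (commutator_image_inter cab cac cbc ind); apply: image.
Qed.

Lemma decomposition_permutation (K : fieldType) (n k q : nat)
    (u v u' v' : 'I_(n + k) -> 'rV[K]_n) (w w' : 'I_(n + k) -> 'rV[K]_q.+2)
    (T : tensor K n n q.+2) :
    (0 < q)%N ->
    T = \sum_i outer (u i) (v i) (w i) -> (forall i, w i 0 ord0 != 0) ->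
    T = \sum_i outer (u' i) (v' i) (w' i) -> (forall i, w' i 0 ord0 != 0) ->
    pairwise_independent w -> slice T ord0 \in unitmx ->
    (forall l : 'I_q.+1, l != ord0 -> exists m : 'I_q.+1,
       [/\ m != ord0, m != l & H (n + k) (normalized_slices T ord0)
         (normalized_slices T l) (normalized_slices T m)]) ->
  exists s : 'S_(n + k), forall i,
    outer (u i) (v i) (w i) = outer (u' (s i)) (v' (s i)) (w' (s i)).
Proof.
move=> q_gt0 Tuvw w0 Tuvw' w'0 w_ind uT HT.
have [Q [R [QR1 ulE RE QE]]] := diagonal_extension Tuvw w0 uT.
have [Q' [R' [QR1' ulE' RE' QE']]] := diagonal_extension Tuvw' w'0 uT.
have [||||N uN conj] := @conjugate_extensions K n k q
  (fun l => Q *m diag_mx (ratio w l) *m R)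
  (fun l => Q' *m diag_mx (ratio w' l) *m R') q_gt0.
- by move=> l l'; apply: diagonal_conjugates_commute.
- by move=> l l'; apply: diagonal_conjugates_commute.
- by move=> l; rewrite ulE ulE'.
- by move=> l /HT; rewrite ulE => -[m Hm]; exists m; rewrite !ulE.
have uS := mxlift_unit n uN.
have [uQ uR] := mulmx1_unit QR1; have [uQ' uR'] := mulmx1_unit QR1'.
(* The change of eigenbasis between the two extensions. *)
pose G := R *m mxlift n N *m Q'.
have uG : G \in unitmx by rewrite !unitmx_mul uR uS uQ'.
have GR' : G *m R' = R *m mxlift n N by rewrite -mulmxA QR1' mulmx1.
have QG : Q *m G = mxlift n N *m Q' by rewrite !mulmxA QR1 mul1mx.
have GdG l : G *m diag_mx (ratio w' l) = diag_mx (ratio w l) *m G.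
  apply: (row_free_inj (A := R')); first by rewrite row_free_unit.
  rewrite /G -!mulmxA [Q' *m (_ *m R')]mulmxA conj !mulmxA (mulmx1C QR1) mul1mx.
  by rewrite -[RHS]mulmxA QR1' mulmx1.
clearbody G.
have [s [ratio_s G0]] := monomial_intertwiner uG GdG (ratio_inj w_ind w0).
(* [mxlift n N] fixes the first [n] coordinates, so [G] relates the truncated factors; being
   monomial, it does so term by term, with the same scalar for both factors. *)
have v_E i : v i = G i (s i) *: v' (s i).
  have GV : G *m \matrix_i v' i = \matrix_i v i.
    rewrite -RE' -RE mulmx_lsub GR' -{1}[R]hsubmxK mul_row_block.
    by rewrite row_mxKl mulmx0 mulmx1 addr0.
  rewrite -(rowK v i) -GV row_mul mulmx_sum_row (bigD1 (s i)) //= !mxE rowK.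
  by rewrite big1 ?addr0 // => j js; rewrite mxE G0 ?scale0r.
have Q_E i : col (s i) (usubmx Q') = G i (s i) *: col i (usubmx Q).
  have -> : usubmx Q' = usubmx Q *m G.
    rewrite mul_usub_mx QG -{2}[Q']vsubmxK mul_block_col.
    by rewrite col_mxKu mul0mx mul1mx addr0.
  apply/colP=> j; rewrite !mxE (bigD1 i) //= big1 ?addr0 ?mxE 1?mulrC // => l li.
  by rewrite (G0 l (s i)) ?mulr0 // (inj_eq perm_inj) eq_sym.
exists s => i; apply: slice_inj => l; rewrite !slice_outer.
(* Equal ratios reduce slice [l] to the first slice. *)
have [rho [-> ->]] : exists rho, w i 0 l = rho * w i 0 ord0 /\
    w' (s i) 0 l = rho * w' (s i) 0 ord0.
  case: (unliftP ord0 l) => [l' ->|->]; last by exists 1; rewrite !mul1r.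
  exists (ratio w l' 0 i); split; first by rewrite mxE divfK.
  by rewrite -ratio_s mxE divfK.
rewrite -!scalerA; congr (_ *: _).
rewrite !scalemxAl -QE -QE' Q_E v_E -scalemxAr.
by rewrite -scalemxAr -scalemxAl.
Qed.

(** * Rank of the tensor and correctness of the algorithm *)

Lemma rank_lower_bound (K : fieldType) (n q r s : nat) (T : tensor K n n q.+2)
    (a b : 'I_q.+1) (u v : 'I_s -> 'rV[K]_n) (w : 'I_s -> 'rV[K]_q.+2) :
    T = \sum_i outer (u i) (v i) (w i) -> slice T ord0 \in unitmx ->
    \rank (Defs.commutator (normalized_slices T a) (normalized_slices T b))
      = (2 * (r - n))%N ->
  (r <= s)%N.
Proof.
move=> -> uT; have ns := size_bound uT.
rewrite !normalized_slices_sum => rk; rewrite slice_sum_outer in uT.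
have := commutator_bound (fun i => w i 0 (lift ord0 a))
  (fun i => w i 0 (lift ord0 b)) uT.
(* [n + (r - n)] is the maximum of [n] and [r], so truncated subtraction is harmless. *)
by rewrite rk -mulnDr leq_pmul2l // -maxnE geq_max => /andP[].
Qed.

(** A zero term could be deleted, leaving fewer than [r] terms. *)
Lemma rank_one_terms (K : fieldType) (m n p r : nat) (T : tensor K m n p)
    (u : 'I_r -> 'rV[K]_m) (v : 'I_r -> 'rV[K]_n) (w : 'I_r -> 'rV[K]_p) :
    (forall s (u' : 'I_s -> 'rV[K]_m) (v' : 'I_s -> 'rV[K]_n)
       (w' : 'I_s -> 'rV[K]_p),
       T = \sum_i outer (u' i) (v' i) (w' i) -> (r <= s)%N) ->
    T = \sum_i outer (u i) (v i) (w i) ->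
  decomposition T (fun i => outer (u i) (v i) (w i)).
Proof.
move=> min_r TE; split=> // i; split; last by exists (u i), (v i), (w i).
apply: contraTneq isT => ti0.
have : (r <= r.-1)%N.
  apply: (min_r _ (u \o lift i) (v \o lift i) (w \o lift i)).
  by rewrite TE (bigD1_ord i) //= ti0 add0r.
by rewrite leqNgt prednK ?leqnn // (leq_ltn_trans (leq0n i)).
Qed.

Lemma decomposition_outer (K : fieldType) (m n p r : nat) (T : tensor K m n p)
    (t : 'I_r -> tensor K m n p) :
    decomposition T t ->
  exists u v w, forall i, t i = outer (u i) (v i) (w i).
Proof.
case=> t1 _.
have /fin_all_exists[x xE] : forall i, exists x : triple K m n p,
    t i = outer x.1.1 x.1.2 x.2.
  by move=> i; have [_ [u [v [w ->]]]] := t1 i; exists (u, v, w).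
by exists (fun i => (x i).1.1), (fun i => (x i).1.2), (fun i => (x i).2).
Qed.

Lemma sd_applicable (K : fieldType) (r p : nat) (M N : 'M[K]_r)
    (c : 'I_r -> 'rV[K]_p) (S : tensor K r r p) :
    M \in unitmx -> N \in unitmx -> pairwise_independent c ->
    (forall k, slice S k = M *m diag_mx (\row_i c i 0 k) *m N) ->
  exists (a b : 'I_r -> 'rV[K]_r) (c : 'I_r -> 'rV[K]_p),
    [/\ S = \sum_i outer (a i) (b i) (c i), free [seq a i | i : 'I_r],
        free [seq b i | i : 'I_r] & pairwise_independent c].
Proof.
move=> uM uN ind SE; exists (fun i => row i M^T), (fun i => row i N), c.
split=> //.
- apply: slice_inj => k; rewrite slice_sum_outer lincombE SE.
  congr (_ *m _ *m _).
    by apply/matrixP=> i j; rewrite !mxE.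
  by apply/matrixP=> i j; rewrite !mxE.
- by apply: (free_rows (A := M^T)); rewrite ?row_free_unit ?unitmx_tr.
by apply: (free_rows (A := N)); rewrite ?row_free_unit.
Qed.

Lemma pairwise_independentZ (K : fieldType) (p r : nat) (w : 'I_r -> 'rV[K]_p)
    (c : 'I_r -> K) :
    (forall i, c i != 0) -> pairwise_independent w ->
  pairwise_independent (fun i => c i *: w i).
Proof.
move=> c0 ind i j /ind; rewrite !free_cons !span_seq1 !nil_free !andbT.
rewrite !span_nil !memv0 scaler_eq0 negb_or c0 /=.
case/andP=> nin ->; rewrite andbT; apply: contra nin => /vlineP[x e].
apply/vlineP; exists ((c i)^-1 * x * c j).
by rewrite -2!scalerA -e scalerA mulVf ?scale1r.
Qed.

Lemma mxsub_widen (K : fieldType) (n k : nat) (le : (n <= n + k)%N)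
    (Z : 'M[K]_(n + k)) :
  mxsub (widen_ord le) (widen_ord le) Z = ulsubmx Z.
Proof. by apply/matrixP=> i j; rewrite !mxE; congr (Z _ _); apply: val_inj. Qed.

(** Each slice of [T] is the first slice times the top-left block of the same slice of [T'];
    truncating and multiplying is linear, so a sum of outer products for [T'] gives one for [T]. *)
Lemma algorithm2_sum (K : fieldType) (n r q : nat)
    (CE : {ffun 'I_q.+1 -> 'M[K]_n} -> {ffun 'I_q.+1 -> 'M[K]_r})
    (SD : tensor K r r q.+2 -> {ffun 'I_r -> triple K r r q.+2})
    (T : tensor K n n q.+2) (hr : admissible_size n r) :
    slice T ord0 \in unitmx ->
    commuting_extension (normalized_slices T) (CE (normalized_slices T)) ->
    let T' := tensor_of_slices (fun k => if unlift ord0 k is Some k'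
      then CE (normalized_slices T) k' else 1%:M) in
    T' = \sum_i term (SD T' i) ->
  T = \sum_i term (algorithm2 CE SD T hr i).
Proof.
move=> uT [_ [le_nr ZE]] T' T'E; apply: slice_inj => k.
have -> : slice T k = slice T ord0
    *m mxsub (widen_ord le_nr) (widen_ord le_nr) (slice T' k).
  rewrite slice_of_slices; case: (unliftP ord0 k) => [k' ->|->].
    by rewrite ZE ffunE mulKVmx.
  rewrite [mxsub _ _ _](_ : _ = 1%:M) ?mulmx1 //.
  by apply/matrixP=> i j; rewrite !mxE -!(inj_eq val_inj).
rewrite (bool_irrelevance le_nr (proj1 (andP hr))) {1}T'E !slice_sum.
rewrite linear_sum mulmx_sumr; apply: eq_bigr => i _.
rewrite !slice_outer linearZ -scalemxAr /=; congr (_ *: _).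
rewrite row_mul rowK trmx_mul trmxK -mulmxA; congr (_ *m _).
by apply/matrixP=> j j'; rewrite !mxE !big_ord1 !mxE.
Qed.

Theorem theorem5p1 (K : fieldType) (n r q : nat) (hp : (4 <= q.+2)%N)
  (u v : 'I_r -> 'rV[K]_n) (w : 'I_r -> 'rV[K]_q.+2) (T : tensor K n n q.+2)
  (hT : T = \sum_i outer (u i) (v i) (w i))
  (hw : pairwise_independent w)
  (hw1 : forall i, w i 0 ord0 != 0)
  (hT1 : slice T ord0 \in unitmx)
  (hH : forall l : 'I_q.+1, l != ord0 ->
     exists m : 'I_q.+1, [/\ m != ord0, m != l &
       H r (normalized_slices T ord0) (normalized_slices T l)
           (normalized_slices T m)]) :
  [/\ has_tensor_rank T r,
      exists hr : admissible_size n r,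
        forall (CE : {ffun 'I_q.+1 -> 'M[K]_n} -> {ffun 'I_q.+1 -> 'M[K]_r})
               (SD : tensor K r r q.+2 -> {ffun 'I_r -> triple K r r q.+2}),
          ce_spec CE -> sd_spec SD ->
          decomposition T (fun i => term (algorithm2 CE SD T hr i))
    & essentially_unique_decomposition T r].
Proof.
have [k r_nk] : exists k, r = (n + k)%N.
  by exists (r - n)%N; rewrite subnKC // (@size_bound _ _ _ _ u v w) // -hT.
subst r; have q_gt0 : (0 < q)%N by apply: ltnW hp.
have [m [_ _ Hm]] := hH (lift ord0 (Ordinal q_gt0)) isT.
have min_r s (u' v' : 'I_s -> 'rV[K]_n) (w' : 'I_s -> 'rV[K]_q.+2) :
    T = \sum_i outer (u' i) (v' i) (w' i) -> (n + k <= s)%N.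
  move=> /rank_lower_bound; apply=> //; have [[+ _ _] _] := Hm.
  by rewrite /Im mxrank_tr => rk; apply: rk.
split.
- split.
    by exists (fun i => outer (u i) (v i) (w i)); apply: rank_one_terms.
  move=> s t dt; have [u' [v' [w' tE]]] := decomposition_outer dt.
  by apply: (min_r _ u' v' w'); rewrite dt.2; apply: eq_bigr.
(* The sum of two images has dimension [3 * k] inside a space of dimension [n], which gives the
   upper bound on the size. *)
- have hr : admissible_size n (n + k).
    rewrite /admissible_size leq_addr mulnDr (mulSn 3) addnC leq_add2r.
    have [_ [+ _ _]] := Hm; rewrite addKn => <-; exact: rank_leq_row.
  exists hr => CE SD ceP sdP.
  have [Q [R [QR1 ulE _ _]]] := diagonal_extension hT hw1 hT1.
  set A := normalized_slices T in ulE ceP *.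
  have extZ : commuting_extension A (CE A).
    apply: ceP => //; exists [ffun l => Q *m diag_mx (ratio w l) *m R]; split.
      by move=> l l'; rewrite !ffunE; apply: diagonal_conjugates_commute.
    by exists (leq_addr k n) => l; rewrite ffunE mxsub_widen ulE.
  have [cZ [le_nr ZE]] := extZ.
  have [||||N uN conj] := @conjugate_extensions K n k q
    (fun l => Q *m diag_mx (ratio w l) *m R) (CE A) q_gt0.
  + by move=> l l'; apply: diagonal_conjugates_commute.
  + exact: cZ.
  + by move=> l; rewrite ulE -ZE mxsub_widen.
  + by move=> l /hH; rewrite ulE => -[m' Hm']; exists m'; rewrite !ulE.
  have uS := mxlift_unit n uN.
  have [uQ uR] := mulmx1_unit QR1.
  apply: rank_one_terms min_r _; apply: (algorithm2_sum _ hT1 extZ); apply: sdP.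
  (* [conj] writes the output of [CE] as [S^-1 Q D R S] with [S = mxlift n N]. Dividing [w i] by its
     first coordinate turns the first diagonal factor into the identity. *)
  apply: (@sd_applicable _ _ _ (invmx (mxlift n N) *m Q) (R *m mxlift n N)
    (fun i => (w i 0 ord0)^-1 *: w i)).
  + by rewrite unitmx_mul unitmx_inv uS.
  + by rewrite unitmx_mul uR.
  + by apply: pairwise_independentZ hw => i; rewrite invr_eq0.
  move=> l; rewrite slice_of_slices; case: (unliftP ord0 l) => [l' ->|->].
    rewrite -[LHS](mulKmx uS) conj !mulmxA.
    congr (_ *m _ *m diag_mx _ *m _ *m _).
    by apply/rowP=> i; rewrite !mxE mulrC.
  rewrite (_ : \row_i _ = const_mx 1) ?diag_const_mx ?mulmx1.
    by rewrite -mulmxA [Q *m _]mulmxA QR1 mul1mx mulVmx.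
  by apply/rowP=> i; rewrite !mxE mulVf.
move=> t t' dt dt'.
(* Both decompositions are matched with the given one, whose [w i] are pairwise independent. *)
have perm_of t0 : decomposition T t0 -> exists s : 'S_(n + k), forall i,
    outer (u i) (v i) (w i) = t0 (s i).
  move=> dt0; have [u' [v' [w' tE]]] := decomposition_outer dt0.
  have TE : T = \sum_i outer (u' i) (v' i) (w' i).
    by rewrite dt0.2; apply: eq_bigr.
  have w'0 i : w' i 0 ord0 != 0.
    by apply: (first_coef_neq0 hT hw1 TE hT1 Hm); rewrite -tE; case: (dt0.1 i).
  have [s sE] := decomposition_permutation q_gt0 hT hw1 TE w'0 hw hT1 hH.
  by exists s => i; rewrite sE tE.
have [s sE] := perm_of _ dt; have [s' sE'] := perm_of _ dt'.
by exists (s'^-1 * s)%g => i; rewrite permM -sE sE' permKV.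
Qed.
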